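(* For each positive integer $M$ let $N=4M^2+2$ and let $\diamond(N)$ be the Diamond ensemble with $n=1$ and $r_j=4j$ for $1\le j\le M$ (with arbitrary phases). Then $$\frac{1}{\sqrt N}+o\left(\frac{1}{\sqrt N}\right)\le D_{\sup,\mathrm{cap}}(\diamond(N))<\frac{4+2\sqrt2}{\sqrt N},$$ where the $o$-term refers to $M\to\infty$ (equivalently $N\to\infty$).
   Context: The Diamond ensemble in question: for a positive integer $M$ put $p=2M-1$, $r_j=4j$ for $1\le j\le M$ and $r_{2M-j}=r_j$; the total number of points is $N=2+\sum_{j=1}^{p}r_j=4M^2+2$. Put $$z_j=1-\frac{1+r_j+2\sum_{k=1}^{j-1}r_k}{N-1},\qquad 1\le j\le p$$ (so $z_j=1-\frac{1+4j^2}{N-1}$ for $1\le j\le M$). For arbitrary phases $\theta_j\in[0,2\pi]$, the set $\diamond(N)\subset\mathbb{S}^2$ consists of the North pole $(0,0,1)$, the South pole $(0,0,-1)$ and the points $$x_j^i=\left(\sqrt{1-z_j^2}\cos\left(\tfrac{2\pi i}{r_j}+\theta_j\right),\sqrt{1-z_j^2}\sin\left(\tfrac{2\pi i}{r_j}+\theta_j\right),z_j\right),\quad 1\le j\le p,\ 1\le i\le r_j.$$ Spherical cap discrepancy. Let $\mu$ be Lebesgue (surface) measure on the unit sphere $\mathbb{S}^2\subset\mathbb{R}^3$, so $\mu(\mathbb{S}^2)=4\pi$, and let $\mathrm{cap}$ be the set of all spherical caps $\{x\in\mathbb{S}^2:\langle x,u\rangle\ge t\}$, $u\in\mathbb{S}^2$,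 $t\in[-1,1]$. For an $N$-point set $\omega_N\subset\mathbb{S}^2$, $$D_{\sup,\mathrm{cap}}(\omega_N)=\sup_{C\in\mathrm{cap}}\left|\frac{\#(\omega_N\cap C)}{N}-\frac{\mu(C)}{4\pi}\right|.$$ *)

(* Defs.v *)
From mathcomp Require Import all_boot all_order all_algebra finmap.
From mathcomp Require Import all_classical all_reals all_analysis.
Import Order.TTheory GRing.Theory Num.Theory.
Import numFieldNormedType.Exports.

Set Implicit Arguments.
Unset Strict Implicit.
Unset Printing Implicit Defensive.

Local Open Scope classical_set_scope.
Local Open Scope ring_scope.

Section Sphere.
Context {R : realType}.

Definition vec3 (a b c : R) : 'rV[R]_3 := \row_i [:: a; b; c]`_i.

Definition dot (x y : 'rV[R]_3) : R := \sum_i x 0 i * y 0 i.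

(* The library's norm on row vectors is the sup norm, hence the inner product. *)
Definition sphere2 : set 'rV[R]_3 := [set x | dot x x = 1].

Definition spherical_cap (u : 'rV[R]_3) (t : R) : set 'rV[R]_3 :=
  [set x | sphere2 x /\ t <= dot x u].

Definition caps : set (set 'rV[R]_3) :=
  [set C | exists u t, [/\ sphere2 u, -1 <= t <= 1 & C = spherical_cap u t]].

(* Colatitude a.1 in [0, pi] and longitude a.2 in [0, 2 pi]. *)
Definition sphere_param (a : R * R) : 'rV[R]_3 :=
  vec3 (sin a.1 * cos a.2) (sin a.1 * sin a.2) (cos a.1).

(* Surface measure as the surface integral of the indicator of A: sphere_param
   is injective up to a null set, and the norm of the cross product of its
   partial derivatives is sin a.1. *)
Definition surface_measure (A : set 'rV[R]_3) : \bar R :=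
  (\int[@lebesgue_measure R \x @lebesgue_measure R]_(a in
      (`[0, pi] `*` `[0, 2 * pi])%R)
    ((\1_A (sphere_param a) * sin a.1)%R)%:E)%E.

(* For finite w; the set under the supremum is nonempty and bounded, so that
   the real-valued sup is the actual supremum. *)
Definition cap_discrepancy (w : set 'rV[R]_3) : R :=
  sup [set `| #|` fset_set (w `&` C)|%:R / #|` fset_set w|%:R
             - fine (surface_measure C) / (4 * pi) | | C in caps].

End Sphere.

Section Diamond.
Context {R : realType}.
Variable M : nat.

Definition diamond_N : nat := (4 * M ^ 2 + 2)%N.

Definition diamond_p : nat := (2 * M - 1)%N.

Definition diamond_r (j : nat) : nat :=
  if (j <= M)%N then (4 * j)%N else (4 * (2 * M - j))%N.

Definition diamond_z (j : nat) : R :=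
  1 - (1 + (diamond_r j)%:R + 2 * \sum_(1 <= k < j) (diamond_r k)%:R)
      / (diamond_N%:R - 1).

Definition diamond_point (theta : nat -> R) (j i : nat) : 'rV[R]_3 :=
  let rho := Num.sqrt (1 - diamond_z j ^+ 2) in
  let phi := 2 * pi * i%:R / (diamond_r j)%:R + theta j in
  vec3 (rho * cos phi) (rho * sin phi) (diamond_z j).

Definition diamond (theta : nat -> R) : set 'rV[R]_3 :=
  [set vec3 0 0 1; vec3 0 0 (-1)] `|`
  [set x | exists j i, [/\ (1 <= j <= diamond_p)%N,
     (1 <= i <= diamond_r j)%N & x = diamond_point theta j i]].

Definition diamond_phases (theta : nat -> R) : Prop :=
  forall j, (1 <= j <= diamond_p)%N -> 0 <= theta j <= 2 * pi.

End Diamond.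

(* Main.v *)
(** Slice the sphere by latitude.  At colatitude [x] a cap with axis
    [(s cos be, s sin be, c)] and threshold [t] meets the parallel in an arc
    [|longitude - be| <= H x].  On the [j]-th parallel of the ensemble the number
    of equally spaced points in this arc differs from [r_j H / pi] by at most
    [1], whatever the phase.  On the other hand the area of the cap is the
    integral of [2 H x sin x], and [z_j] is the exact midpoint of a latitude
    band of normalized area [r_j / (N - 1)]; replacing [H] on this band by its
    value at [z_j] costs at most [r_j <= 4 M] times the oscillation of [H / pi].
    Since [H] changes monotonicity at most once, its total variation is at most
    [2 pi], and the errors add up to at most
    [(2 M - 1) + 8 M + 3 = 10 M + 2 < (4 + 2 sqrt 2) sqrt N].
    For the lower bound, the closed northern hemisphere contains the whole
    equator of [4 M] points, hence [N / 2 + 2 M] points in all. *)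
Require Import Defs.
From mathcomp Require Import all_boot all_order all_algebra finmap.
From mathcomp Require Import all_classical all_reals all_analysis.
From mathcomp Require Import measurable_realfun ring lra zify.
Import Order.TTheory GRing.Theory Num.Theory.
Import numFieldNormedType.Exports.
Local Open Scope classical_set_scope.
Local Open Scope ring_scope.

(** * Arcs and equally spaced points *)

(* An empty arc gets the half-width [sup set0 = 0], like an arc reduced to a
   point: counts within [1] and measures cannot tell them apart. *)
Definition halfwidth {R : realType} (A q : R) : R :=
  sup [set x | 0 <= x <= pi /\ q <= A * cos x].

Section Halfwidth.
Context {R : realType}.
Implicit Types A B q x y : R.

Lemma le_cos x y : 0 <= x -> x <= y -> y <= pi -> cos y <= cos x.
Proof.
move=> x0 xy ypi; rewrite le_eqVlt; move: xy; rewrite le_eqVlt.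
case/orP => [/eqP->|xy]; first by rewrite eqxx.
by rewrite ltr_cos ?xy ?orbT // in_itv /=; apply/andP; split; lra.
Qed.

Lemma halfwidth_has_ubound A q :
  has_ubound [set x : R | 0 <= x <= pi /\ q <= A * cos x].
Proof. by exists pi => x [/andP[]]. Qed.

Lemma halfwidth_ge0 A q : 0 <= halfwidth A q.
Proof.
rewrite /halfwidth; set E := [set _ | _].
have [->|/set0P [x Ex]] := eqVneq E set0; first by rewrite sup0.
have [/andP[x0 _] _] := Ex; apply: (le_trans x0); apply: ub_le_sup => //.
exact: halfwidth_has_ubound.
Qed.

Lemma halfwidth_le_pi A q : halfwidth A q <= pi.
Proof.
rewrite /halfwidth; set E := [set _ | _].
have [->|/set0P E0] := eqVneq E set0; first by rewrite sup0 pi_ge0.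
by apply: ge_sup => // x [/andP[]].
Qed.

Lemma le_halfwidth A q x : 0 <= x <= pi -> q <= A * cos x ->
  x <= halfwidth A q.
Proof.
by move=> x0 qx; apply: ub_le_sup; first exact: halfwidth_has_ubound.
Qed.

(** As [A >= 0], the function [A * cos] is nonincreasing on [[0, pi]], so the set under the supremum
    is an initial segment; whether the supremum itself belongs to it is left open. *)
Lemma lt_halfwidth A q x : 0 <= A -> 0 <= x -> x < halfwidth A q ->
  q <= A * cos x.
Proof.
rewrite /halfwidth; set E := [set _ | _] => A0 x0 xs.
have [E0|/set0P E0] := eqVneq E set0.
  by move: xs; rewrite E0 sup0 ltNge x0.
have [y [/andP[y0 ypi] qy] xy] := sup_gt E0 xs.
by apply: (le_trans qy); apply: ler_wpM2l => //; apply: le_cos => //; exact: ltW.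
Qed.

Lemma halfwidth_mono A q A' q' :
  (forall x, 0 <= x <= pi -> q <= A * cos x -> q' <= A' * cos x) ->
  halfwidth A q <= halfwidth A' q'.
Proof.
move=> H; rewrite {1}/halfwidth; set E := [set _ | _].
have [->|/set0P E0] := eqVneq E set0.
  by rewrite sup0 halfwidth_ge0.
by apply: ge_sup => // x [x0 qx]; apply: le_halfwidth => //; exact: H.
Qed.

Lemma sum_between_le (a b : R) (r : nat) : a <= b + 1 ->
  \sum_(0 <= i < r) (a <= i%:R <= b)%R%:R <= b - a + 1 :> R.
Proof.
move=> ab.
(* Truncating the bound at [r - 1] makes it inductive; the maximum with 0 covers an empty range. *)
suff : \sum_(0 <= i < r) (a <= i%:R <= b)%R%:R <=
       Num.max 0 (Num.min b (r%:R - 1) - a + 1) :> R.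
  move=> h; apply: (le_trans h).
  rewrite ge_max; apply/andP; split; first lra.
  by rewrite lerD2r lerD2r ge_min lexx.
elim: r => [|r IH]; first by rewrite big_geq // le_max lexx.
rewrite big_nat_recr //=; move: IH; set S := \sum_(_ <= _ < _) _.
rewrite -(natr1 r) addrK => IH.
case: (boolP (a <= r%:R <= b)) => [/andP[ar rb]|_] /=.
  rewrite (min_idPr rb); move: IH; rewrite le_max.
  have -> : Num.min b (r%:R - 1) = r%:R - 1 by apply/min_idPr; lra.
  by case/orP => h; rewrite le_max; apply/orP; right; lra.
rewrite addr0; apply: (le_trans IH); rewrite ge_max !le_max lexx /=.
apply/orP; right; rewrite !lerD2r le_min ge_min lexx /= ge_min.
by apply/orP; right; lra.
Qed.

(** As [-1 <= a] and [b <= r], every integer strictly between [a] and [b] is an index of the sum. *)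
Lemma sum_between_ge (a b : R) (r : nat) : -1 <= a -> b <= r%:R ->
  b - a - 1 <= \sum_(0 <= i < r) (a < i%:R < b)%R%:R :> R.
Proof.
move=> a1 br.
suff : Num.min b r%:R - a - 1 <= \sum_(0 <= i < r) (a < i%:R < b)%R%:R :> R.
  by rewrite (min_idPl br).
elim: r {br} => [|r IH].
  rewrite big_geq //; have : Num.min b 0 <= 0 :> R by rewrite ge_min lexx orbT.
  by move=> ?; lra.
rewrite big_nat_recr //=; move: IH; set S := \sum_(_ <= _ < _) _.
have S0 : 0 <= S by apply: sumr_ge0 => i _; rewrite ler0n.
rewrite -(natr1 r) => IH.
have [rb|br] := ltP r%:R b; last first.
  rewrite andbF addr0; apply: le_trans IH; rewrite !lerD2r !(min_idPl _) //.
  by apply: (le_trans br); lra.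
rewrite andbT; move: IH; rewrite (min_idPr (ltW rb)) => IH.
have h : Num.min b (r%:R + 1) <= r%:R + 1 by rewrite ge_min lexx orbT.
have [ar|ra] := ltP a r%:R; rewrite ?mulr1n ?mulr0n; lra.
Qed.

Lemma cosD2pi_nat x (n : nat) : cos (x + 2 * pi * n%:R) = cos x.
Proof.
rewrite -[RHS](periodicn (@cosD2pi R) n); congr (cos (x + _)).
by rewrite -[RHS]mulr_natr [pi *+ 2]mulr2n; ring.
Qed.

Section ArcCount.
Variables (A q : R) (r : nat).
Hypotheses (A0 : 0 <= A) (r0 : (0 < r)%N).
Let d : R := 2 * pi / r%:R.
Let F (al : R) : R := \sum_(0 <= i < r) (q <= A * cos (al + d * i%:R))%R%:R.

Let rR0 : 0 < r%:R :> R. Proof. by rewrite ltr0n. Qed.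
Let d0 : 0 < d. Proof. by rewrite /d divr_gt0 ?mulr_gt0 ?pi_gt0. Qed.
Let dr : d * r%:R = 2 * pi. Proof. by rewrite /d divfK ?gt_eqF. Qed.

(** Turning by one step permutes the points cyclically: the last angle becomes the first one plus a
    full turn. *)
Let F_shift al : F (al + d) = F al.
Proof.
rewrite /F -(prednK r0) big_nat_recr // [RHS]big_nat_recl //= [RHS]addrC.
congr (_ + _).
  apply: eq_bigr => i _.
  have -> : al + d + d * i%:R = al + d * i.+1%:R by rewrite -(natr1 i); ring.
  by [].
have -> : al + d + d * r.-1%:R = al + d * 0%:R + 2 * pi * 1%:R.
  have -> : r.-1%:R = r%:R - 1 :> R.
    by rewrite -[X in _ = X%:R - _](prednK r0) -(natr1 r.-1) addrK.
  by rewrite -dr; ring.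
by rewrite cosD2pi_nat.
Qed.

Let F_shift_nat al (n : nat) : F (al + d * n%:R) = F al.
Proof.
elim: n => [|n IH]; first by rewrite mulr0 addr0.
by rewrite -natr1 mulrDr mulr1 addrA F_shift.
Qed.

Let F_norm al : exists2 al', - pi <= al' < - pi + d & F al = F al'.
Proof.
pose m : int := Num.floor ((al + pi) / d).
have /andP[m1 m2] : m%:~R <= (al + pi) / d < m%:~R + 1.
  by rewrite -[1]/(1%:~R) -intrD floor_itv.
move: m1 m2; rewrite ler_pdivlMr // ltr_pdivrMr // => m1 m2.
exists (al - d * m%:~R); first by apply/andP; split; lra.
case: m {m1 m2} => n.
  by rewrite -{1}(subrK (d * n%:R) al) F_shift_nat.
rewrite NegzE mulrNz mulrN opprK.
by rewrite F_shift_nat.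
Qed.

(* After translating the phase into [[- pi, - pi + d)] all the angles lie in
   [[- pi, pi)], where the arc is the single interval [[- h, h]]. *)
Lemma arc_count al :
  `| \sum_(1 <= i < r.+1) (q <= A * cos (2 * pi * i%:R / r%:R + al))%R%:R
     - r%:R * halfwidth A q / pi | <= 1.
Proof.
have -> : \sum_(1 <= i < r.+1) (q <= A * cos (2 * pi * i%:R / r%:R + al))%R%:R
   = F al.
  rewrite -F_shift /F big_add1 /=; apply: eq_bigr => i _.
  have -> : 2 * pi * i.+1%:R / r%:R + al = al + d + d * i%:R.
    by rewrite /d -(natr1 i); field; rewrite gt_eqF.
  by [].
have [be /andP[be1 be2] ->] := F_norm al.
have h0 := halfwidth_ge0 A q; have hpi := halfwidth_le_pi A q.
move: h0 hpi; set h := halfwidth A q => h0 hpi.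
have ppi := pi_gt0 R.
have len : r%:R * h / pi = (h - be) / d - (- h - be) / d.
  have pn0 : pi != 0 :> R by rewrite gt_eqF.
  by rewrite /d; move: (pi : R) pn0 => p p0; field; rewrite p0 gt_eqF.
have ang i : (i < r)%N -> - pi <= be + d * i%:R < pi.
  move=> ir; have : i%:R + 1 <= r%:R :> R by rewrite natr1 ler_nat.
  rewrite -(ler_pM2l d0) mulrDr dr mulr1 => h1.
  have : 0 <= d * i%:R by rewrite mulr_ge0 // ltW.
  by move=> ?; apply/andP; split; lra.
(* End points are left undecided: the open arc bounds the count from below, the closed one from
   above. Both implications survive the convention [h = 0] for an empty arc. *)
have PQ x : - pi <= x < pi -> ((- h < x < h) ==> (q <= A * cos x)) &&
    ((q <= A * cos x) ==> (- h <= x <= h)).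
  move=> xpi; have nx : 0 <= `|x| <= pi.
    by rewrite normr_ge0 ler_norml; lra.
  apply/andP; split; apply/implyP.
    by rewrite -ltr_norml -cos_norm; exact: lt_halfwidth.
  by rewrite -ler_norml -cos_norm; exact: le_halfwidth.
rewrite len ler_norml; apply/andP; split.
  (* The window for [be] puts [(- h - be) / d] above [-1] and [(h - be) / d] at most at [r]. *)
  have := @sum_between_ge ((- h - be) / d) ((h - be) / d) r.
  rewrite ler_pdivlMr // ler_pdivrMr // [r%:R * d]mulrC dr.
  move=> /(_ ltac:(lra) ltac:(lra)) h1.
  rewrite lerBrDr addrC; apply: (le_trans h1); apply: ler_sum_nat => i ir.
  have /PQ /andP[/implyP h2 _] := ang i ir.
  rewrite ler_nat ltr_pdivrMr // ltr_pdivlMr // ltrBlDr ltrBrDr.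
  rewrite (mulrC i%:R) (addrC _ be).
  by case: (boolP (_ && _)) => // /h2 ->.
have := @sum_between_le ((- h - be) / d) ((h - be) / d) r.
have hd : (- h - be) / d <= (h - be) / d.
  by rewrite ler_pM2r ?invr_gt0 //; lra.
move=> /(_ ltac:(lra)) h1.
rewrite lerBlDr addrC; apply: le_trans h1; apply: ler_sum_nat => i ir.
have /PQ /andP[_ /implyP h2] := ang i ir.
rewrite ler_nat ler_pdivrMr // ler_pdivlMr // lerBlDr lerBrDr.
rewrite (mulrC i%:R) (addrC _ be).
by case: (boolP (q <= _)) => // /h2 ->.
Qed.
End ArcCount.
End Halfwidth.

(** * Monotonicity of the arcs of a cap *)

(** The witness [V] is a variation function: up to a constant it is [F] before the peak [p] and
    [- F] after it. As a difference of two values of [F] it stays in [[-B, B]]. *)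
Lemma unimodal_variation {R : realType} (a b B p : R) (F : R -> R) :
  (forall x, 0 <= F x <= B) ->
  (forall x y, a < x -> x <= y -> y < b -> y <= p -> F x <= F y) ->
  (forall x y, a < x -> x <= y -> y < b -> p <= x -> F y <= F x) ->
  exists V : R -> R,
    (forall x y, a < x -> x <= y -> y < b -> `|F y - F x| <= V y - V x) /\
    (forall x y, V y - V x <= 2 * B).
Proof.
move=> FB incr decr.
exists (fun x => F (Num.min x p) - F (Num.max x p)); split=> [x y ax xy yb|x y].
  have [xp|px] := leP x p; have [yp|py] := leP y p.
  - have := incr x y ax xy yb yp.
    by rewrite ler_norml => ?; apply/andP; split; lra.
  - have h1 := incr x p ax xp (lt_trans py yb) (lexx _).
    have h2 := decr p y (lt_le_trans ax xp) (ltW py) yb (lexx _).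
    by rewrite ler_norml => *; apply/andP; split; lra.
  - by have := lt_le_trans px (le_trans xy yp); rewrite ltxx.
  - have := decr x y ax xy yb (ltW px).
    by rewrite ler_norml => ?; apply/andP; split; lra.
have [/andP[? ?] /andP[? ?]] := (FB (Num.min x p), FB (Num.max x p)).
have [/andP[? ?] /andP[? ?]] := (FB (Num.min y p), FB (Num.max y p)).
lra.
Qed.

Section CapHalfwidth.
Context {R : realType}.
Variables s c t : R.
Implicit Types x y : R.

(** This is the arc at colatitude [x] of a cap with threshold [t] whose axis has horizontal length
    [s] and height [c]; the longitude of the axis only rotates the arc. *)
Definition cap_halfwidth x := halfwidth (s * sin x) (t - c * cos x).
Local Notation H := cap_halfwidth.

(** Dividing the arc condition by the sine leaves [s * cos w] on one side and
    [(t - c * cos x) / sin x] on the other. The hypothesis says, after clearing denominators, that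
    this threshold is no larger at [y] than at [x]. *)
Lemma cap_halfwidth_le x y : 0 < x < pi -> 0 < y < pi ->
  0 <= t * (sin y - sin x) - c * sin (y - x) -> H x <= H y.
Proof.
move=> xpi ypi D0; apply: halfwidth_mono => w _.
have sx := sin_gt0_pi xpi; have sy := sin_gt0_pi ypi.
move: D0; rewrite sinB => D0 h.
rewrite -(ler_pM2l sx).
have h1 : sin y * (t - c * cos x) <= sin y * (s * sin x * cos w).
  by rewrite ler_pM2l.
have : sin x * (s * sin y * cos w) = sin y * (s * sin x * cos w) by ring.
by lra.
Qed.

(* The sign of this quantity decides how the arcs at colatitudes [m - d] and
   [m + d] compare. *)
Lemma sin_chord (m d : R) :
  t * (sin (m + d) - sin (m - d)) - c * sin ((m + d) - (m - d)) =
  2 * sin d * (t * cos m - c * cos d).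
Proof.
have -> : m + d - (m - d) = d + d by ring.
by rewrite sinB !sinD; ring.
Qed.

(** Apply [sin_chord] to the midpoint and the half-distance of [x] and [y]. *)
Lemma cap_halfwidth_incr x y : 0 < x -> x <= y -> y < pi ->
  c * cos ((y - x) / 2) <= t * cos ((x + y) / 2) -> H x <= H y.
Proof.
move=> x0 xy ypi h; apply: cap_halfwidth_le; [lra|lra|].
have := sin_chord ((x + y) / 2) ((y - x) / 2).
have -> : (x + y) / 2 + (y - x) / 2 = y by field.
have -> : (x + y) / 2 - (y - x) / 2 = x by field.
move=> ->; rewrite mulr_ge0 ?subr_ge0 // mulr_ge0 //.
by apply: sin_ge0_pi; apply/andP; split; lra.
Qed.

Lemma cap_halfwidth_decr x y : 0 < x -> x <= y -> y < pi ->
  t * cos ((x + y) / 2) <= c * cos ((y - x) / 2) -> H y <= H x.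
Proof.
move=> x0 xy ypi h; apply: cap_halfwidth_le; [lra|lra|].
have := sin_chord ((x + y) / 2) ((x - y) / 2).
have -> : (x + y) / 2 + (x - y) / 2 = x by field.
have -> : (x + y) / 2 - (x - y) / 2 = y by field.
have e : (x - y) / 2 = - ((y - x) / 2) by field.
move=> ->; rewrite e sinN cosN.
have : 0 <= sin ((y - x) / 2) by apply: sin_ge0_pi; apply/andP; split; lra.
move: h; move: (sin _) (cos _) (cos _) => u v w h u0.
by have := mulr_ge0 u0 (_ : 0 <= c * v - t * w); rewrite subr_ge0 => /(_ h) ?; lra.
Qed.

(** The midpoint lies between the half-distance and [pi] minus the half-distance. This settles the
    sign in [sin_chord] when [c] dominates [t]. *)
Lemma cos_mid_le x y : 0 < x -> x <= y -> y < pi ->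
  `|cos ((x + y) / 2)| <= cos ((y - x) / 2).
Proof.
move=> x0 xy ypi; rewrite ler_norml; apply/andP; split; last by apply: le_cos; lra.
rewrite lerNl -[cos ((x + y) / 2)]cosN -cosDpi; apply: le_cos; lra.
Qed.

Lemma cap_halfwidth_variation : exists V : R -> R,
  (forall x y, 0 < x -> x <= y -> y < pi -> `|H y - H x| <= V y - V x) /\
  (forall x y, V y - V x <= 2 * pi).
Proof.
have ppi := pi_gt0 R.
have HB x : 0 <= H x <= pi by rewrite halfwidth_ge0 halfwidth_le_pi.
have HB' x : 0 <= pi - H x <= pi by have /andP[? ?] := HB x; apply/andP; split; lra.
suff [[p [h1 h2]]|[p [h1 h2]]] :
   (exists p,
   (forall x y, 0 < x -> x <= y -> y < pi -> y <= p -> H x <= H y) /\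
   (forall x y, 0 < x -> x <= y -> y < pi -> p <= x -> H y <= H x)) \/
   (exists p,
   (forall x y, 0 < x -> x <= y -> y < pi -> y <= p -> H y <= H x) /\
   (forall x y, 0 < x -> x <= y -> y < pi -> p <= x -> H x <= H y)).
- exact: unimodal_variation HB h1 h2.
(* Passing to [pi - H] turns a valley into a peak and keeps all oscillations. *)
- have [||V [V1 V2]] := @unimodal_variation _ 0 pi pi p _ HB'.
  + by move=> x y x0 xy ypi yp; rewrite lerD2l lerN2; exact: h1.
  + by move=> x y x0 xy ypi yp; rewrite lerD2l lerN2; exact: h2.
  exists V; split=> // x y x0 xy ypi.
  by rewrite distrC (_ : H x - H y = pi - H y - (pi - H x)); [exact: V1|ring].
have cle : forall a b u v : R, `|a| <= b -> `|u| <= v -> a * u <= b * v.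
  move=> a b u v ab uv; apply: le_trans (ler_norm _) _.
  by rewrite normrM; apply: ler_pM.
(* If [t] is at most [c] in absolute value, [H] is monotone on the whole interval, and a [p] at one
   end of it makes the other clause vacuous. *)
have [tc|ct] := leP `|t| `|c|.
  have [c0|c0] := leP 0 c.
    left; exists 0; split=> [|x y x0 xy ypi _]; first by move=> *; lra.
    apply: cap_halfwidth_decr => //; apply: cle; last exact: cos_mid_le.
    by rewrite -(ger0_norm c0).
  left; exists pi; split=> [x y x0 xy ypi _|]; last by move=> *; lra.
  apply: cap_halfwidth_incr => //; rewrite -lerN2 -!mulNr.
  apply: cle; last exact: cos_mid_le.
  by rewrite normrN -(ltr0_norm c0).
have t0 : t != 0 by apply: contraTneq ct => ->; rewrite normr0 -leNgt.
have r1 : -1 <= c / t <= 1.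
  by rewrite -ler_norml normrM normfV ler_pdivrMr ?normr_gt0 // mul1r ltW.
(* The only colatitude where the monotonicity changes. *)
pose p := acos (c / t); have p0 : 0 <= p by exact: acos_ge0.
have ppi' : p <= pi by exact: acos_lepi.
have cp : c = t * cos p by rewrite acosK ?in_itv //= mulrC divfK.
have cosp d : 0 <= d -> d <= pi -> cos (p + d) <= cos p * cos d <= cos (p - d).
  move=> d0 dpi; rewrite cosD cosB gerBl lerDl andbb mulr_ge0 //.
    by apply: sin_ge0_pi; rewrite p0.
  by apply: sin_ge0_pi; rewrite d0.
(* With [m] the midpoint and [d] the half-distance, [y <= p] reads [m <= p - d] and [p <= x] reads
   [p + d <= m]; then [cosp] compares [cos m] with [cos p * cos d]. *)
have left_ x y : 0 < x -> x <= y -> y < pi -> y <= p ->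
    cos p * cos ((y - x) / 2) <= cos ((x + y) / 2).
  move=> x0 xy ypi yp; have /andP[_ h] := cosp ((y - x) / 2) ltac:(lra) ltac:(lra).
  by apply: (le_trans h); apply: le_cos; lra.
have right_ x y : 0 < x -> x <= y -> y < pi -> p <= x ->
    cos ((x + y) / 2) <= cos p * cos ((y - x) / 2).
  move=> x0 xy ypi yp; have /andP[h _] := cosp ((y - x) / 2) ltac:(lra) ltac:(lra).
  by apply: le_trans h; apply: le_cos; lra.
have [tp|tn] := ltP 0 t; [left|right]; exists p; split=> x y x0 xy ypi yp.
- by apply: cap_halfwidth_incr => //; rewrite cp -mulrA ler_pM2l //; exact: left_.
- by apply: cap_halfwidth_decr => //; rewrite cp -mulrA ler_pM2l //; exact: right_.
- apply: cap_halfwidth_decr => //; rewrite cp -mulrA ler_wnM2l //; exact: left_.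
- apply: cap_halfwidth_incr => //; rewrite cp -mulrA ler_wnM2l //; exact: right_.
Qed.
End CapHalfwidth.

(** * Area of a cap *)

Section ArcMeasure.
Context {R : realType}.
Implicit Types A B q x y : R.
Local Notation mu := (@lebesgue_measure R).

Lemma lebesgue_measure_itv_max (b1 b2 : bool) (a b : R) :
  mu [set` Interval (BSide b1 a) (BSide b2 b)] = (Num.max 0 (b - a))%:E.
Proof.
rewrite lebesgue_measure_itv /= lte_fin; have [ab|ba] := ltP a b.
  by rewrite -EFinB max_r // subr_ge0 ltW.
by rewrite max_l // subr_le0.
Qed.

(** Open intervals inside and closed ones outside have the same measure, so the end points of [E]
    need not be decided. Two intervals allow for an arc that wraps around. *)
Lemma lebesgue_measure_between (E : set R) (a b c d : R) :
  measurable E -> b <= c ->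
  `]a, b[ `|` `]c, d[ `<=` E -> E `<=` `[a, b] `|` `[c, d] ->
  mu E = (Num.max 0 (b - a) + Num.max 0 (d - c))%:E.
Proof.
move=> mE bc lowE Eup; apply/eqP; rewrite eq_le; apply/andP; split.
  have mU : measurable (`[a, b] `|` `[c, d] : set R).
    by apply: measurableU; exact: measurable_itv.
  apply: (le_trans (le_measure mu _ _ Eup)); rewrite ?inE //.
  apply: (le_trans (measureU2 mu _ _)); [exact: measurable_itv..|].
  by rewrite EFinD -!(lebesgue_measure_itv_max true false).
have mU : measurable (`]a, b[ `|` `]c, d[ : set R).
  by apply: measurableU; exact: measurable_itv.
apply: le_trans (le_measure mu _ _ lowE); rewrite ?inE //.
rewrite measureU; [|exact: measurable_itv..|].
  by rewrite EFinD -!(lebesgue_measure_itv_max false true).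
rewrite -subset0 => x [] /=; rewrite !in_itv /= => /andP[_ xb] /andP[cx _].
by have := lt_trans xb (le_lt_trans bc cx); rewrite ltxx.
Qed.

Lemma measurable_arc A q be :
  measurable [set y | 0 <= y <= 2 * pi /\ q <= A * cos (y - be)].
Proof.
have -> : [set y | 0 <= y <= 2 * pi /\ q <= A * cos (y - be)] =
    `[0, 2 * pi]%classic `&` (fun y => A * cos (y - be)) @^-1` `[q, +oo[%classic.
  by apply/seteqP; split => y /=; rewrite !in_itv /= andbT.
have mf : measurable_fun setT (fun y => A * cos (y - be)).
  apply: measurable_funM => //; apply: measurableT_comp.
    exact: (continuous_measurable_fun (@continuous_cos R)).
  exact: measurable_funB.
apply: measurableI; first exact: measurable_itv.
by rewrite -[X in measurable X]setTI; apply: mf.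
Qed.

(** The half-width is at most [pi], so the arc around [be] overflows [[0, 2 * pi]] on one side only:
    on the left if [be <= pi], on the right otherwise. The overflow reappears at the opposite
    end. *)
Lemma arc_measure A q be : 0 <= A -> 0 <= be <= 2 * pi ->
  mu [set y | 0 <= y <= 2 * pi /\ q <= A * cos (y - be)] =
  (2 * halfwidth A q)%:E.
Proof.
move=> A0 /andP[be0 be2]; have mE := measurable_arc A q be.
have h0 := halfwidth_ge0 A q; have hpi := halfwidth_le_pi A q.
have inE y x : `|x| = x -> cos x = cos (y - be) -> x < halfwidth A q ->
    q <= A * cos (y - be).
  by move=> x0 <-; apply: lt_halfwidth => //; rewrite -x0.
have inE1 y : `|y - be| < halfwidth A q -> q <= A * cos (y - be).
  by apply: inE; rewrite ?normr_id ?cos_norm.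
have outE1 y : `|y - be| <= pi -> q <= A * cos (y - be) ->
    `|y - be| <= halfwidth A q.
  by move=> ypi; rewrite -cos_norm; apply: le_halfwidth; rewrite normr_ge0.
have cosC y : cos (2 * pi + be - y) = cos (y - be).
  rewrite (_ : 2 * pi + be - y = - (y - be) + pi *+ 2).
    by rewrite cosD2pi cosN.
  by rewrite mulr2n; ring.
have cosC' y : cos (2 * pi - be + y) = cos (y - be).
  rewrite (_ : 2 * pi - be + y = (y - be) + pi *+ 2).
    by rewrite cosD2pi.
  by rewrite mulr2n; ring.
move: h0 hpi inE1 outE1 inE; set h := halfwidth A q => h0 hpi inE1 outE1 inE.
have [bepi|pibe] := leP be pi.
- rewrite (@lebesgue_measure_between _ (Num.max 0 (be - h)) (be + h)
     (2 * pi + be - h) (2 * pi)) //; [|lra| |].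
  + have [|] := leP 0 (be - h); have [|] := leP 0 (2 * pi - (2 * pi + be - h)) => *.
    * by congr EFin; rewrite max_r; lra.
    * by congr EFin; rewrite max_r; lra.
    * by congr EFin; rewrite max_r; lra.
    * by exfalso; lra.
  + move=> y /=; rewrite !in_itv /= gt_max => -[/andP[/andP[y0 y1] y2]|/andP[y1 y2]].
      split; first by apply/andP; split; lra.
      by apply: inE1; rewrite ltr_norml; apply/andP; split; lra.
    split; first by apply/andP; split; lra.
    by apply: (inE _ (2 * pi + be - y)) => //; [rewrite ger0_norm|]; lra.
  + move=> y /= [/andP[y0 y1] qy]; rewrite !in_itv /= ge_max.
    have [ybe|bey] := leP y (be + pi).
      have : `|y - be| <= pi by rewrite ler_norml; apply/andP; split; lra.
      move=> /outE1 /(_ qy); rewrite ler_norml => /andP[? ?]; left.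
      by rewrite y0 /=; apply/andP; split; lra.
    right; have : 2 * pi + be - y <= h.
      by apply: le_halfwidth; rewrite ?cosC //; apply/andP; split; lra.
    by move=> ?; apply/andP; split; lra.
rewrite (@lebesgue_measure_between _ 0 (be + h - 2 * pi)
   (be - h) (Num.min (2 * pi) (be + h))) //; [|lra| |].
- have [|] := leP (2 * pi) (be + h); have [|] := leP 0 (be + h - 2 * pi - 0) => *.
  * by congr EFin; rewrite max_r; lra.
  * by exfalso; lra.
  * by congr EFin; rewrite max_r; lra.
  * by congr EFin; rewrite max_r; lra.
- move=> y /=; rewrite !in_itv /= lt_min => -[/andP[y1 y2]|/andP[y1 /andP[y2 y3]]].
    split; first by apply/andP; split; lra.
    by apply: (inE _ (2 * pi - be + y)) => //; [rewrite ger0_norm|]; lra.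
  split; first by apply/andP; split; lra.
  by apply: inE1; rewrite ltr_norml; apply/andP; split; lra.
- move=> y /= [/andP[y0 y1] qy]; rewrite !in_itv /= le_min.
  have [ybe|bey] := leP (be - pi) y.
    have : `|y - be| <= pi by rewrite ler_norml; apply/andP; split; lra.
    move=> /outE1 /(_ qy); rewrite ler_norml => /andP[? ?]; right.
    by rewrite y1 /=; apply/andP; split; lra.
  left; have : 2 * pi - be + y <= h.
    by apply: le_halfwidth; rewrite ?cosC' //; apply/andP; split; lra.
  by move=> ?; apply/andP; split; lra.
Qed.

End ArcMeasure.

Section CapMeasure.
Context {R : realType}.
Local Notation mu := (@lebesgue_measure R).

Lemma dot_vec3 (a b c a' b' c' : R) :
  dot (vec3 a b c) (vec3 a' b' c') = a * a' + b * b' + c * c'.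
Proof. by rewrite /dot !big_ord_recl big_ord0 /vec3 !mxE /= addr0 addrA. Qed.

Lemma dot_sphere_param (s be c : R) (a : R * R) :
  dot (sphere_param a) (vec3 (s * cos be) (s * sin be) c) =
  s * sin a.1 * cos (a.2 - be) + c * cos a.1.
Proof. by rewrite dot_vec3 cosB; ring. Qed.

Lemma sphere2_param (a : R * R) : sphere2 (sphere_param a).
Proof.
rewrite /sphere2 /= dot_vec3 -!expr2 !exprMn -mulrDr cos2Dsin2 mulr1 addrC.
exact: cos2Dsin2.
Qed.

Lemma spherical_cap_param (s be c t : R) (a : R * R) :
  spherical_cap (vec3 (s * cos be) (s * sin be) c) t (sphere_param a) <->
  t - c * cos a.1 <= s * sin a.1 * cos (a.2 - be).
Proof.
rewrite /spherical_cap /= dot_sphere_param lerBlDr.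
by split=> [[]|] //; split=> //; exact: sphere2_param.
Qed.

Section WithCap.
Variables s be c t : R.
Hypotheses (s0 : 0 <= s) (be0 : 0 <= be <= 2 * pi).
Let H := cap_halfwidth s c t.
Let D : set (R * R) := (`[0, pi] `*` `[0, 2 * pi])%R.
Let f (a : R * R) : \bar R :=
  ((t - c * cos a.1 <= s * sin a.1 * cos (a.2 - be))%R%:R * sin a.1)%:E.

Let mD : measurable D.
Proof. by apply: measurableX; exact: measurable_itv. Qed.

Let mf : measurable_fun setT (f \_ D).
Proof.
apply/(measurable_restrictT _ mD); apply: measurable_funTS.
have mc := continuous_measurable_fun (@continuous_cos R).
have ms : measurable_fun setT (fun a : R * R => sin a.1).
  apply: measurableT_comp => //.
  exact: (continuous_measurable_fun (@continuous_sin R)).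
apply/measurable_EFinP; apply: measurable_funM => //.
have -> : (fun a : R * R =>
    (t - c * cos a.1 <= s * sin a.1 * cos (a.2 - be))%R%:R : R) =
  \1_[set a : R * R | t - c * cos a.1 <= s * sin a.1 * cos (a.2 - be)].
  by apply/funext => a; rewrite indicE mem_setE.
apply/measurable_indicP.
suff mb : measurable_fun setT (fun a : R * R =>
    t - c * cos a.1 <= s * sin a.1 * cos (a.2 - be)).
  by have := mb measurableT [set true] I; rewrite setTI.
apply: measurable_fun_ler.
- apply: measurable_funB => //; apply: measurable_funM => //.
  exact: measurableT_comp.
- apply: measurable_funM => //; first exact: measurable_funM.
  by apply: measurableT_comp => //; apply: measurable_funB.
Qed.

Let f0 a : (0 <= (f \_ D) a)%E.
Proof.
apply: erestrict_ge0 => -[x y] [/= + _]; rewrite in_itv /= => xpi.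
by rewrite lee_fin mulr_ge0 // sin_ge0_pi.
Qed.

Let F_eq x : `[0, pi]%classic x ->
  fubini_F mu (f \_ D) x = (2 * H x * sin x)%:E.
Proof.
rewrite /= in_itv /= => xpi.
have sx : 0 <= sin x := sin_ge0_pi xpi.
pose E := [set y | 0 <= y <= 2 * pi /\
  t - c * cos x <= s * sin x * cos (y - be)].
transitivity (\int[mu]_y ((cst (sin x)%:E) \_ E) y)%E.
  apply: eq_integral => y _; rewrite !patchE /D /f /=.
  have [/set_mem[/= _ yE]|yD] := boolP ((x, y) \in D).
    have [/set_mem[_ /= ->]|yE'] := boolP (y \in E); first by rewrite mul1r.
    case: (boolP (_ <= _)) => h; last by rewrite mul0r.
    by case/negP: yE'; apply/mem_set; split => //; move: yE; rewrite in_itv.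
  have [/set_mem[yE _]|//] := boolP (y \in E).
  by case/negP: yD; apply/mem_set; split => /=; rewrite in_itv.
rewrite -integral_mkcond integral_cst; last exact: measurable_arc.
have muE : mu E = (2 * H x)%:E by apply: arc_measure => //; rewrite mulr_ge0.
have -> : (2 * H x * sin x)%:E = ((sin x)%:E * mu E)%E.
  by rewrite muE -EFinM mulrC.
by [].
Qed.

(** Measurability is not read off the supremum: on [[0, pi]] the function is the inner integral in
    Tonelli's theorem, by [F_eq]. *)
Lemma measurable_cap_halfwidth :
  measurable_fun `[0, pi] (fun x => (2 * cap_halfwidth s c t x * sin x)%:E).
Proof.
apply: (eq_measurable_fun (fubini_F mu (f \_ D))).
  by move=> x /set_mem; exact: F_eq.
by apply: measurable_funTS; exact: measurable_fun_fubini_tonelli_F.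
Qed.

Lemma surface_measure_cap :
  surface_measure (spherical_cap (vec3 (s * cos be) (s * sin be) c) t) =
  (\int[mu]_(x in `[0%R, pi]) (2 * cap_halfwidth s c t x * sin x)%:E)%E.
Proof.
transitivity (\int[mu \x mu]_(a in D) f a)%E.
  apply: eq_integral => a _; rewrite /f indicE; congr ((nat_of_bool _)%:R * _)%:E.
  apply/idP/idP => [/set_mem/spherical_cap_param //|h].
  exact/mem_set/spherical_cap_param.
rewrite integral_mkcond fubini_tonelli1 // [RHS]integral_mkcond.
apply: eq_integral => x _; rewrite patchE.
have [/set_mem/F_eq //|xpi] := boolP (x \in _).
rewrite /fubini_F integral0_eq // => y _; rewrite patchE /D.
by case: (boolP ((x, y) \in _)) => // /set_mem[/= /mem_set h _]; case/negP: xpi.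
Qed.

End WithCap.
End CapMeasure.

(** * Integration over latitude bands *)

Section SineWeightedIntegral.
Context {R : realType}.
Local Notation mu := (@lebesgue_measure R).

Lemma integral_sin (k a b : R) : a <= b ->
  (\int[mu]_(x in `[a, b]) (k * sin x)%:E)%E = (k * (cos a - cos b))%:E.
Proof.
rewrite le_eqVlt => /predU1P[<-|ab].
  by rewrite set_itv1 integral_set1 subrr mulr0.
rewrite (@continuous_FTC2 _ _ (fun x => - k * cos x)) //.
- by rewrite -EFinB; congr EFin; ring.
- apply: continuous_subspaceT => x; apply: cvgM; first exact: cvg_cst.
  exact: continuous_sin.
- have cc : continuous (fun x : R => - k * cos x).
    by move=> x; apply: cvgM; [exact: cvg_cst|exact: continuous_cos].
  split.
  + by move=> x _; apply: derivableM => //; exact: derivable_cos.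
  + by apply: cvg_at_right_filter; exact: cc.
  + by apply: cvg_at_left_filter; exact: cc.
- move=> x _; rewrite derive1E deriveM // ?derive_val.
  by rewrite scaler0 addr0 /GRing.scale /=; ring.
Qed.

Variables (h : R -> R) (B : R).
Hypothesis mh : measurable_fun `[0, pi] (fun x => (h x * sin x)%:E).
Hypothesis hB : forall x, 0 <= h x <= B.

Definition sin_integral (a b : R) : R :=
  fine (\int[mu]_(x in `[a, b]) (h x * sin x)%:E)%E.
Local Notation J := sin_integral.

Let sub_mh a b : 0 <= a -> b <= pi ->
  measurable_fun `[a, b] (fun x => (h x * sin x)%:E).
Proof.
move=> a0 bpi; apply: measurable_funS mh => //.
by move=> x /=; rewrite !in_itv /= => /andP[? ?]; apply/andP; split; lra.
Qed.

Let h_ge0 a b x : 0 <= a -> b <= pi -> `[a, b]%classic x ->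
  0 <= h x * sin x.
Proof.
move=> a0 bpi /=; rewrite in_itv /= => /andP[ax xb].
have /andP[? _] := hB x; rewrite mulr_ge0 // sin_ge0_pi //.
by apply/andP; split; lra.
Qed.

Let le_int (m a b : R) : 0 <= a -> a <= b -> b <= pi ->
  (forall x, a <= x <= b -> h x <= m) ->
  (\int[mu]_(x in `[a, b]) (h x * sin x)%:E <= (m * (cos a - cos b))%:E)%E.
Proof.
move=> a0 ab bpi hm; rewrite -integral_sin //.
apply: ge0_le_integral => //.
- by move=> x xab; rewrite lee_fin; exact: h_ge0 xab.
- exact: sub_mh.
- apply/measurable_EFinP; apply: measurable_funM => //; apply: measurable_funTS.
  exact: (continuous_measurable_fun (@continuous_sin R)).
- move=> x /=; rewrite in_itv /= => /[dup] xab /andP[ax xb].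
  rewrite lee_fin ler_wpM2r ?hm // sin_ge0_pi //.
  by apply/andP; split; lra.
Qed.

Lemma sin_integralE a b : 0 <= a -> a <= b -> b <= pi ->
  (\int[mu]_(x in `[a, b]) (h x * sin x)%:E)%E = (J a b)%:E.
Proof.
move=> a0 ab bpi; rewrite /J fineK // ge0_fin_numE.
  apply: le_lt_trans (ltry (B * (cos a - cos b))).
  by apply: le_int => // x _; have /andP[] := hB x.
by apply: integral_ge0 => x xab; rewrite lee_fin; exact: h_ge0 xab.
Qed.

Lemma sin_integral_le m a b : 0 <= a -> a <= b -> b <= pi ->
  (forall x, a <= x <= b -> h x <= m) -> J a b <= m * (cos a - cos b).
Proof.
by move=> a0 ab bpi hm; rewrite -lee_fin -sin_integralE //; exact: le_int.
Qed.

Lemma sin_integral_ge m a b : 0 <= a -> a <= b -> b <= pi ->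
  (forall x, a <= x <= b -> m <= h x) -> m * (cos a - cos b) <= J a b.
Proof.
move=> a0 ab bpi hm.
have cab : 0 <= cos a - cos b by rewrite subr_ge0; apply: le_cos.
(* The bound [m] may be negative, while the comparison of integrals is for nonnegative functions. *)
apply: (@le_trans _ _ (Num.max 0 m * (cos a - cos b))).
  by rewrite ler_wpM2r // le_max lexx orbT.
rewrite -lee_fin -sin_integralE // -integral_sin //.
apply: ge0_le_integral => //.
- move=> x /=; rewrite in_itv /= => /andP[ax xb].
  rewrite lee_fin mulr_ge0 ?le_max ?lexx // sin_ge0_pi //.
  by apply/andP; split; lra.
- apply/measurable_EFinP; apply: measurable_funM => //; apply: measurable_funTS.
  exact: (continuous_measurable_fun (@continuous_sin R)).
- exact: sub_mh.
- move=> x /=; rewrite in_itv /= => /[dup] xab /andP[ax xb].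
  rewrite lee_fin ler_wpM2r //; last first.
    by rewrite ge_max hm // andbT; have /andP[] := hB x.
  by rewrite sin_ge0_pi //; apply/andP; split; lra.
Qed.

Lemma sin_integralD a b c : 0 <= a -> a <= b -> b <= c -> c <= pi ->
  J a c = J a b + J b c.
Proof.
move=> a0 ab bc cpi; apply: EFin_inj.
have [b0 bpi ac] : [/\ 0 <= b, b <= pi & a <= c] by split; lra.
rewrite EFinD -!sin_integralE //.
have U : `[a, c]%classic = `[a, b] `|` `]b, c] :> set R.
  by rewrite -itv_bndbnd_setU ?bnd_simp.
rewrite U.
have mbc : measurable_fun `]b, c] (fun x => (h x * sin x)%:E).
  apply: (@measurable_funS _ _ _ _ `[b, c]%classic) => //; last exact: sub_mh.
  by move=> x /=; rewrite !in_itv /= => /andP[/ltW -> ->].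
rewrite ge0_integral_setU //.
- by rewrite (integral_itv_obnd_cbnd mbc).
- by rewrite -U; exact: sub_mh.
- by rewrite -U => x xac; rewrite lee_fin; exact: h_ge0 xac.
- apply/disj_setPS => y [/=]; rewrite 2!in_itv /= => /andP[_ yb] /andP[].
  by rewrite ltNge yb.
Qed.

Lemma sin_integral_sum (phi : nat -> R) (n : nat) :
  (forall j, (j < n)%N -> phi j <= phi j.+1) -> 0 <= phi 0%N -> phi n <= pi ->
  J (phi 0%N) (phi n) = \sum_(0 <= j < n) J (phi j) (phi j.+1).
Proof.
move=> incr p0; elim: n incr => [|n IH] incr pn.
  rewrite big_geq //; apply: EFin_inj; rewrite -sin_integralE //.
  by rewrite set_itv1 integral_set1.
have h0n : forall k, (k <= n)%N -> phi 0%N <= phi k.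
  by elim=> // k IHk kn; apply: (le_trans (IHk (ltnW kn))); apply: incr; exact: ltnW.
have nn := incr n (leqnn _).
rewrite big_nat_recr //= -IH; first by apply: sin_integralD => //; exact: h0n.
  by move=> j jn; apply: incr; exact: ltnW.
by apply: le_trans pn.
Qed.

End SineWeightedIntegral.

(** * The Diamond ensemble *)

Section DiamondHeights.
Context {R : realType}.
Variable M : nat.
Hypothesis M0 : (0 < M)%N.
Local Notation p := (diamond_p M).
Local Notation r := (diamond_r M).
Local Notation z := (@diamond_z R M).

Lemma diamond_r_gt0 j : (1 <= j <= p)%N -> (0 < r j)%N.
Proof. by rewrite /diamond_r /diamond_p; case: ifP; lia. Qed.

Lemma diamond_r_le j : (r j <= 4 * M)%N.
Proof. by rewrite /diamond_r; case: ifP; lia. Qed.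

Lemma sum_diamond_r_le j : (j <= M)%N ->
  (\sum_(1 <= k < j.+1) r k = 2 * j * (j + 1))%N.
Proof.
elim: j => [|j IH] jM; first by rewrite big_geq.
by rewrite big_nat_recr // -[LHS]/(_ + _)%N IH 1?ltnW // /diamond_r jM; lia.
Qed.

Lemma sum_diamond_r : (\sum_(1 <= k < p.+1) r k = 4 * M ^ 2)%N.
Proof.
(* The [k]-th parallel past the equator has [4 * (M - k)] points. The term [2 * i * (i + 1)] is
   moved to the left to avoid truncated subtraction. *)
have H i : (i < M)%N -> (\sum_(1 <= k < (M + i).+1) r k + 2 * i * (i + 1) =
    2 * M * (M + 1) + 4 * M * i)%N.
  elim: i => [|i IH] iM; first by rewrite addn0 sum_diamond_r_le //; lia.
  rewrite addnS big_nat_recr // -[X in (X + _)%N]/(_ + _)%N.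
  have := IH (ltnW iM); rewrite /diamond_r ifF; last by apply/negbTE; lia.
  move: (\sum_(1 <= i0 < (M + i).+1) _)%N => S.
  have -> : (2 * M - (M + i).+1 = M - i.+1)%N by lia.
  have : (M = (M - i.+1) + i.+1)%N by lia.
  move: (M - i.+1)%N => k ->; nia.
have -> : p = (M + M.-1)%N by rewrite /diamond_p; lia.
have := H M.-1 ltac:(lia).
move: (\sum_(1 <= k < (M + M.-1).+1) _)%N => S.
have : (M = M.-1.+1)%N by lia.
by move: M.-1 => k ->; rewrite expnS expn1; nia.
Qed.

(* Heights of the band boundaries when the areas are normalized by [N - 1]
   instead of [N]: the two poles then weigh [1 / 2] each. *)
Definition band_z (j : nat) : R :=
  1 - (1 + 2 * (\sum_(1 <= k < j.+1) r k)%:R) / ((diamond_N M)%:R - 1).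

Let N1E : (diamond_N M)%:R - 1 = 4 * M%:R ^+ 2 + 1 :> R.
Proof. by rewrite /diamond_N natrD natrM natrX; lra. Qed.

Lemma diamond_N1_gt0 : 0 < (diamond_N M)%:R - 1 :> R.
Proof. by rewrite N1E ltr_wpDl // mulr_ge0 // exprn_ge0. Qed.

Let N1_neq0 : (diamond_N M)%:R - 1 != 0 :> R.
Proof. by rewrite gt_eqF // diamond_N1_gt0. Qed.

Lemma band_z0 : band_z 0 = 1 - 1 / ((diamond_N M)%:R - 1).
Proof. by rewrite /band_z big_geq // mulr0 addr0. Qed.

Lemma band_zp : band_z p = - band_z 0.
Proof.
rewrite band_z0 /band_z sum_diamond_r natrM natrX.
have := N1_neq0; rewrite N1E => h; field; exact: h.
Qed.

(** By Archimedes the normalized area of a band is half its height, here [r j.+1] over [N - 1]. *)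
Lemma band_z_step j :
  band_z j - band_z j.+1 = 2 * (r j.+1)%:R / ((diamond_N M)%:R - 1).
Proof.
rewrite /band_z [in X in _ - X]big_nat_recr //= natrD.
by have := N1_neq0; move: (_ - 1) => n n0; field.
Qed.

Lemma diamond_zE j : z j.+1 = (band_z j + band_z j.+1) / 2.
Proof.
rewrite /diamond_z /band_z [in X in (_ + X) / 2]big_nat_recr //= natrD -natr_sum.
by have := N1_neq0; move: (_ - 1) => n n0; field.
Qed.

Lemma band_z_anti : {homo band_z : i j / (i <= j)%N >-> j <= i}.
Proof.
apply: homo_leq => [x|x y u yx uy|j]; [exact: lexx|exact: le_trans uy yx|].
rewrite -subr_ge0 band_z_step divr_ge0 ?mulr_ge0 //.
by rewrite ltW // diamond_N1_gt0.
Qed.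

Lemma diamond_z_between j : band_z j.+1 <= z j.+1 <= band_z j.
Proof.
have := band_z_anti _ _ (leqnSn j); rewrite diamond_zE => h.
by apply/andP; split; lra.
Qed.

Lemma diamond_z_lt i j : (1 <= i)%N -> (i < j)%N -> (j <= p)%N -> z j < z i.
Proof.
case: i => // i _; case: j => // j ij jp.
have h1 := band_z_anti _ _ (ij : (i.+1 <= j)%N).
rewrite !diamond_zE.
have pos k : (k < p)%N -> 0 < band_z k - band_z k.+1.
  move=> kp; rewrite band_z_step divr_gt0 ?diamond_N1_gt0 // mulr_gt0 // ltr0n.
  exact: diamond_r_gt0.
have := pos j jp; have := pos i ltac:(lia); lra.
Qed.

Lemma band_z_bound j : (j <= p)%N -> -1 < band_z j < 1.
Proof.
move=> jp; have h1 := band_z_anti _ _ (leq0n j); have h2 := band_z_anti _ _ jp.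
have : 0 < 1 / ((diamond_N M)%:R - 1) :> R by rewrite divr_gt0 // diamond_N1_gt0.
by move: h2; rewrite band_zp band_z0 in h1 * => *; apply/andP; split; lra.
Qed.

Lemma diamond_z_bound j : (1 <= j <= p)%N -> -1 < z j < 1.
Proof.
case: j => // j /andP[_ jp]; have /andP[h1 h2] := diamond_z_between j.
have /andP[_ h3] := band_z_bound _ (ltnW jp); have /andP[h4 _] := band_z_bound _ jp.
by rewrite (lt_le_trans h4 h1) (le_lt_trans h2 h3).
Qed.

(** The numerator is [1 + 4 * M + 4 * M * (M - 1)], which equals [N - 1]. *)
Lemma diamond_z_equator : z M = 0.
Proof.
have := @sum_diamond_r_le M.-1 (leq_pred M); rewrite prednK // => S.
rewrite /diamond_z -natr_sum S /diamond_r leqnn.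
have := N1_neq0; rewrite N1E => h.
have -> : (2 * M.-1 * (M.-1 + 1))%:R = 2 * (M%:R - 1) * M%:R :> R.
  rewrite !natrM addn1 prednK //; congr (_ * _ * _).
  by rewrite -[in RHS](prednK M0) -natr1 addrK.
by rewrite natrM; field; exact: h.
Qed.

End DiamondHeights.

(** * Enumeration of the points without repetition *)

Lemma card_fset_set_seq (T : choiceType) (s : seq T) :
  uniq s -> #|` fset_set [set` s]| = size s.
Proof.
move=> us; apply: perm_size; apply: uniq_perm => //.
move=> x; rewrite in_fset_set; last exact: finite_seq.
by apply/idP/idP; rewrite inE.
Qed.

Lemma vec3_inj (R : realType) (a b c a' b' c' : R) :
  vec3 a b c = vec3 a' b' c' -> [/\ a = a', b = b' & c = c'].
Proof.
move=> /rowP e; have e0 := e (@Ordinal 3 0 isT).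
have e1 := e (@Ordinal 3 1 isT); have e2 := e (@Ordinal 3 2 isT).
by move: e0 e1 e2; rewrite !mxE.
Qed.

Section DiamondPoints.
Context {R : realType}.
Variables (M : nat) (theta : nat -> R).
Hypothesis M0 : (0 < M)%N.
Local Notation p := (diamond_p M).
Local Notation r := (diamond_r M).
Local Notation z := (@diamond_z R M).
Local Notation pt := (diamond_point M theta).

Lemma cos_eq1_small (x : R) : 0 < x < 2 * pi -> cos x != 1.
Proof.
move=> x0; have -> : x = (x / 2) *+ 2 by rewrite mulr2n; field.
have h : 0 < sin (x / 2) by apply: sin_gt0_pi; apply/andP; split; lra.
apply/eqP; rewrite cos_mulr2n cos2sin2 => e.
have : 0 < sin (x / 2) ^+ 2 by rewrite exprn_gt0.
by move: e; rewrite mulr2n => *; lra.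
Qed.

(** Coincident points would give [cos (b - a) = 1] for two angles that differ by strictly between 0
    and a full turn; the radius of the parallel is nonzero and cancels. *)
Lemma diamond_point_inj j : (1 <= j <= p)%N ->
  {in index_iota 1 (r j).+1 &, injective (pt j)}.
Proof.
move=> jp.
have H i k : (1 <= i)%N -> (i < k)%N -> (k <= r j)%N -> pt j i <> pt j k.
  move=> i1 ik kr /vec3_inj[].
  have /andP[z1 z2] := @diamond_z_bound R M M0 j jp.
  have rho0 : Num.sqrt (1 - z j ^+ 2) != 0.
    rewrite gt_eqF // sqrtr_gt0 subr_gt0 -ltr_sqrt // sqrtr1 sqrtr_sqr.
    by rewrite ltr_norml z1.
  move=> /(mulfI rho0) ec /(mulfI rho0) es _.
  set a := 2 * pi * i%:R / (r j)%:R + theta j in ec es.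
  set b := 2 * pi * k%:R / (r j)%:R + theta j in ec es.
  have rR : 0 < (r j)%:R :> R by rewrite ltr0n diamond_r_gt0.
  have eab : b - a = 2 * pi * ((k - i)%:R / (r j)%:R).
    by rewrite /a /b natrB ?(ltnW ik) //; ring.
  have : cos (b - a) != 1.
    apply: cos_eq1_small; rewrite eab; have ppi := pi_gt0 R.
    rewrite !mulr_gt0 ?invr_gt0 // ?ltr0n ?subn_gt0 //= gtr_pMr ?mulr_gt0 //.
    by rewrite ltr_pdivrMr // mul1r ltr_nat; lia.
  by rewrite cosB ec es -!expr2 cos2Dsin2 eqxx.
move=> i k; rewrite !mem_index_iota !ltnS => /andP[i1 ir] /andP[k1 kr] e.
case: (ltngtP i k) => // h; first by case: (H i k).
by case: (H k i).
Qed.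

(** An explicit enumeration turns cardinalities of finite sets into sums of indicators. *)
Definition diamond_seq : seq 'rV[R]_3 :=
  [:: vec3 0 0 1, vec3 0 0 (-1) &
    [seq pt j i | j <- index_iota 1 p.+1, i <- index_iota 1 (r j).+1]].

Lemma diamond_seqE : diamond M theta = [set` diamond_seq].
Proof.
rewrite /diamond /diamond_seq; apply/seteqP; split=> x /=; rewrite !inE.
  move=> [[->|->]|[j [i [jp ir ->]]]]; rewrite ?eqxx ?orbT //.
  by apply/orP; right; apply/orP; right; apply/allpairsPdep; exists j, i;
     rewrite !mem_index_iota !ltnS.
move=> /or3P[/eqP->|/eqP->|/allpairsPdep[j [i []]]]; [by left; left|by left; right|].
by rewrite !mem_index_iota !ltnS => jp ir ->; right; exists j, i.
Qed.

(** Heights separate the poles and the parallels from each other; on one parallel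
    [diamond_point_inj] applies. *)
Lemma diamond_seq_uniq : uniq diamond_seq.
Proof.
have pole c : ~~ (-1 < c < 1) -> vec3 0 0 c \notin
    [seq pt j i | j <- index_iota 1 p.+1, i <- index_iota 1 (r j).+1].
  apply: contra => /allpairsPdep[j [i [+ _ /vec3_inj[_ _ ->]]]].
  by rewrite mem_index_iota ltnS; exact: diamond_z_bound.
rewrite /= !inE negb_or !pole ?ltxx ?andbF //= andbT; apply/andP; split.
  by apply/eqP => /vec3_inj[_ _]; lra.
apply: allpairs_uniq_dep; [exact: iota_uniq|by move=> *; exact: iota_uniq|].
move=> _ _ /allpairsPdep[j [i [jp ir ->]]] /allpairsPdep[k [l [kp lr ->]]] /= e.
have ejk : j = k.
  have [_ _ ez] := vec3_inj _ _ _ _ _ _ _ e.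
  move: jp kp; rewrite !mem_index_iota !ltnS => /andP[j1 jp] /andP[k1 kp].
  case: (ltngtP j k) => // h.
    by have := @diamond_z_lt R M M0 j k j1 h kp; rewrite ez ltxx.
  by have := @diamond_z_lt R M M0 k j k1 h jp; rewrite ez ltxx.
subst k; congr existT; apply: (@diamond_point_inj j) => //.
by move: jp; rewrite mem_index_iota ltnS.
Qed.

Lemma diamond_sum (P : pred 'rV[R]_3) :
  (count P diamond_seq)%:R = (P (vec3 0 0 1))%:R + (P (vec3 0 0 (-1)))%:R +
  \sum_(1 <= j < p.+1) \sum_(1 <= i < (r j).+1) (P (pt j i))%:R :> R.
Proof.
rewrite /diamond_seq /= !natrD addrA; congr (_ + _).
rewrite -sum1_count big_mkcond big_allpairs_dep natr_sum; apply: eq_bigr => j _.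
by rewrite natr_sum; apply: eq_bigr => i _; case: (P _).
Qed.

Lemma diamond_card : #|` fset_set (diamond M theta)| = diamond_N M.
Proof.
rewrite diamond_seqE card_fset_set_seq ?diamond_seq_uniq //.
apply/eqP; rewrite -(@eqr_nat R) -count_predT diamond_sum.
have E : \sum_(1 <= j < p.+1) \sum_(1 <= i < (r j).+1) 1 = (4 * M ^ 2)%:R :> R.
  rewrite -sum_diamond_r // natr_sum; apply: eq_bigr => j _.
  by rewrite sumr_const_nat subn1.
by rewrite /= E /diamond_N natrD; apply/eqP; ring.
Qed.

Lemma diamond_cap_card (C : set 'rV[R]_3) :
  (#|` fset_set (diamond M theta `&` C)|)%:R =
  (vec3 0 0 1 \in C)%:R + (vec3 0 0 (-1) \in C)%:R +
  \sum_(1 <= j < p.+1) \sum_(1 <= i < (r j).+1) (pt j i \in C)%:R :> R.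
Proof.
rewrite -(diamond_sum (fun x => x \in C)) -size_filter.
rewrite -[in RHS]card_fset_set_seq ?filter_uniq ?diamond_seq_uniq //.
suff -> : diamond M theta `&` C = [set` [seq x <- diamond_seq | x \in C]] by [].
rewrite diamond_seqE; move: diamond_seq => s.
apply/seteqP; split=> x /=; rewrite mem_filter.
  by move=> [-> /mem_set ->].
by move=> /andP[/set_mem ? ->].
Qed.

End DiamondPoints.

(** * Counting against area *)

Lemma acos_le (R : realType) (x y : R) :
  -1 <= y -> y <= x -> x <= 1 -> acos x <= acos y.
Proof.
move=> y1 yx x1.
have xI : -1 <= x <= 1 by rewrite x1 (le_trans y1 yx).
have yI : -1 <= y <= 1 by rewrite y1 (le_trans yx x1).
rewrite leNgt -ltr_cos ?in_itv /= ?acos_ge0 ?acos_lepi //.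
by rewrite !acosK ?in_itv //= -leNgt.
Qed.

Section CapEstimate.
Context {R : realType}.
Variables (M : nat) (theta : nat -> R) (s be c t : R).
Hypotheses (M0 : (0 < M)%N) (s0 : 0 <= s) (be0 : 0 <= be <= 2 * pi).
Local Notation p := (diamond_p M).
Local Notation r := (diamond_r M).
Local Notation z := (@diamond_z R M).
Local Notation pt := (diamond_point M theta).
Local Notation bz := (@band_z R M).
Local Notation N1 := ((diamond_N M)%:R - 1 : R).
Let H := cap_halfwidth s c t.
Local Notation u := (vec3 (s * cos be) (s * sin be) c).
Let J := sin_integral (fun x => 2 * H x).
Let phi (j : nat) : R := acos (bz j).
Let HB x : 0 <= 2 * H x <= 2 * pi.
Proof. by rewrite mulr_ge0 ?halfwidth_ge0 //= ler_pM2l // halfwidth_le_pi. Qed.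
Let mH := measurable_cap_halfwidth s be c t s0 be0.
Let ppi := pi_gt0 R.
Let N1_gt0 : 0 < N1 := diamond_N1_gt0 M.

Let phi_bound j : (j <= p)%N -> 0 < phi j < pi.
Proof.
move=> jp; have /andP[h1 h2] := @band_z_bound R M M0 j jp.
by rewrite acos_gt0 ?acos_ltpi // ?h1 ?h2 ?(ltW h1) ?(ltW h2).
Qed.

Let cos_phi j : (j <= p)%N -> cos (phi j) = bz j.
Proof.
move=> jp; have /andP[h1 h2] := @band_z_bound R M M0 j jp.
by rewrite acosK // in_itv /= (ltW h1) (ltW h2).
Qed.

Let phi_le j : (j < p)%N -> phi j <= acos (z j.+1) <= phi j.+1.
Proof.
move=> jp; have /andP[h1 h2] := @diamond_z_between R M j.
have /andP[_ h3] := @band_z_bound R M M0 j (ltnW jp).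
have /andP[h4 _] := @band_z_bound R M M0 j.+1 jp.
by apply/andP; split; apply: acos_le; lra.
Qed.

(** Membership becomes the condition counted by [arc_count], with phase [theta j.+1 - be]. Parallel
    [j.+1] lies in the band between boundaries [j] and [j.+1]. *)
Lemma diamond_point_cap j i : (j < p)%N -> (pt j.+1 i \in spherical_cap u t) =
  (t - c * cos (acos (z j.+1)) <= s * sin (acos (z j.+1)) *
     cos (2 * pi * i%:R / (r j.+1)%:R + (theta j.+1 - be))).
Proof.
move=> jp; have /andP[z1 z2] := @diamond_z_bound R M M0 j.+1 jp.
have -> : pt j.+1 i = sphere_param (acos (z j.+1),
    2 * pi * i%:R / (r j.+1)%:R + theta j.+1).
  rewrite /diamond_point /sphere_param /= sin_acos ?acosK //.
    by rewrite in_itv /= !ltW.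
  by rewrite !ltW.
rewrite addrA.
apply/idP/idP => [/set_mem/spherical_cap_param //|h].
exact/mem_set/spherical_cap_param.
Qed.

(** The 1 is the counting error of [arc_count]. The other term is the cost of freezing [H] at the
    parallel: the variation on the band, weighted by at most [4 * M] points. *)
Let band (V : R -> R)
  (HV : forall x y, 0 < x -> x <= y -> y < pi -> `|H y - H x| <= V y - V x) j :
  (j < p)%N ->
  `| \sum_(1 <= i < (r j.+1).+1) (pt j.+1 i \in spherical_cap u t)%:R
     - N1 * J (phi j) (phi j.+1) / (4 * pi) |
  <= 1 + 4 * M%:R * (V (phi j.+1) - V (phi j)) / pi.
Proof.
move=> jp; set ps := acos (z j.+1).
have /andP[pa pb] := phi_le j jp.
have /andP[a0 api] := phi_bound j (ltnW jp).
have /andP[b0 bpi] := phi_bound j.+1 jp.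
rewrite -/ps in pa pb; have r0 : (0 < r j.+1)%N by apply: diamond_r_gt0.
have sps : 0 <= s * sin ps.
  by rewrite mulr_ge0 // sin_ge0_pi //; apply/andP; split; lra.
have := arc_count (s * sin ps) (t - c * cos ps) (r j.+1) sps r0 (theta j.+1 - be).
rewrite -[halfwidth _ _]/(H ps).
have -> : \sum_(1 <= i < (r j.+1).+1) (t - c * cos ps <= s * sin ps *
     cos (2 * pi * i%:R / (r j.+1)%:R + (theta j.+1 - be)))%R%:R =
   \sum_(1 <= i < (r j.+1).+1) (pt j.+1 i \in spherical_cap u t)%:R :> R.
  by apply: eq_bigr => i _; rewrite diamond_point_cap.
set S := \sum_(_ <= _ < _) _ => hS.
set v := V (phi j.+1) - V (phi j).
(* By [HV] the function [V] is nondecreasing, so its increment between [x] and [ps] is at most that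
   over the whole band. *)
have osc x : phi j <= x <= phi j.+1 -> `|H x - H ps| <= v.
  move=> /andP[ax xb]; rewrite /v.
  have [xps|psx] := leP x ps.
    rewrite distrC; apply: (le_trans (HV x ps _ _ _)); try lra.
    have := le_trans (normr_ge0 _) (HV (phi j) x a0 ax ltac:(lra)).
    have := le_trans (normr_ge0 _) (HV ps (phi j.+1) ltac:(lra) pb bpi).
    lra.
  apply: (le_trans (HV ps x _ _ _)); try lra.
  have := le_trans (normr_ge0 _) (HV (phi j) ps a0 pa ltac:(lra)).
  have := le_trans (normr_ge0 _) (HV x (phi j.+1) ltac:(lra) xb bpi).
  lra.
clearbody v.
have step : cos (phi j) - cos (phi j.+1) = 2 * (r j.+1)%:R / N1.
  by rewrite !cos_phi ?(ltnW jp) // band_z_step.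
have JU : J (phi j) (phi j.+1) <= (2 * (H ps + v)) * (2 * (r j.+1)%:R / N1).
  rewrite -step; apply: (sin_integral_le _ (2 * pi)) => //; try lra.
  by move=> x /osc; rewrite ler_norml => /andP[_ ?]; rewrite ler_pM2l //; lra.
have JL : (2 * (H ps - v)) * (2 * (r j.+1)%:R / N1) <= J (phi j) (phi j.+1).
  rewrite -step; apply: (sin_integral_ge _ (2 * pi)) => //; try lra.
  by move=> x /osc; rewrite ler_norml => /andP[? _]; rewrite ler_pM2l //; lra.
(* With area normalized by [N - 1], the integral of a constant half-width over the band is exactly
   the main term of [arc_count]. *)
have conv m : N1 * ((2 * m) * (2 * (r j.+1)%:R / N1)) / (4 * pi) =
    (r j.+1)%:R * m / pi.
  have p0 : pi != 0 :> R by rewrite gt_eqF.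
  have n0 : N1 != 0 by rewrite gt_eqF.
  by move: (N1) n0 (pi : R) p0 => n n0 q q0; field; rewrite n0 q0.
have pi4 : 0 < 4 * pi :> R by lra.
have mono x y : x <= y -> N1 * x / (4 * pi) <= N1 * y / (4 * pi).
  by move=> xy; rewrite ler_pM2r ?invr_gt0 // ler_pM2l.
have := mono _ _ JU; have := mono _ _ JL; rewrite !conv.
have rv : (r j.+1)%:R * v / pi <= 4 * M%:R * v / pi.
  rewrite ler_pM2r ?invr_gt0 // ler_wpM2r //.
    by apply: le_trans (osc ps _); rewrite ?normr_ge0 // pa pb.
  by rewrite -natrM ler_nat diamond_r_le.
move: hS rv; rewrite !ler_norml => /andP[? ?] ? ? ?.
by apply/andP; split; lra.
Qed.

(** The error is [2 * M - 1] from counting, [8 * M] from variation, and 1 for each pole with its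
    polar cap. The range of [S] serves later to replace [N - 1] by [N]. *)
Lemma diamond_cap_estimate :
  let S := fine (surface_measure (spherical_cap u t)) in
  0 <= S <= 4 * pi /\
  `| (#|` fset_set (diamond M theta `&` spherical_cap u t)|)%:R
     - N1 * S / (4 * pi) | <= 10 * M%:R + 1.
Proof.
move=> S; have SJ : S = J 0 pi.
  by rewrite /S surface_measure_cap.
have J_le a b : 0 <= a -> a <= b -> b <= pi -> 0 <= J a b <= 2 * pi * (cos a - cos b).
  move=> a0 ab bpi; apply/andP; split.
    rewrite -[leLHS](mul0r (cos a - cos b)).
    by apply: (sin_integral_ge _ (2 * pi)) => // x _; have /andP[] := HB x.
  by apply: (sin_integral_le _ (2 * pi)) => // x _; have /andP[] := HB x.
split.
  have := J_le 0 pi (lexx _) (ltW ppi) (lexx _).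
  by rewrite cos0 cospi SJ => /andP[-> ?]; lra.
have [V [V1 V2]] := cap_halfwidth_variation s c t.
rewrite diamond_cap_card //.
have /andP[f0 fpi] := phi_bound 0%N (leq0n _).
have /andP[g0 gpi] := phi_bound p (leqnn _).
have phi_step j : (j < p)%N -> phi j <= phi j.+1.
  by move=> /phi_le /andP[]; exact: le_trans.
have phi0p : phi 0%N <= phi p.
  by apply: acos_le; have := @band_z_anti R M 0%N p (leq0n _);
     have := @band_z_bound R M M0 0%N (leq0n _);
     have := @band_z_bound R M M0 p (leqnn _); lra.
have split1 : J 0 pi = J 0 (phi 0%N) +
    \sum_(0 <= j < p) J (phi j) (phi j.+1) + J (phi p) pi.
  rewrite -(sin_integral_sum _ (2 * pi) mH HB phi p phi_step) ?(ltW f0) ?(ltW gpi) //.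
  rewrite -addrA -!(sin_integralD _ (2 * pi) mH HB) ?(ltW f0) ?(ltW gpi) //.
  by rewrite (le_trans phi0p (ltW gpi)).
have /andP[N0 N2] := J_le 0 (phi 0%N) (lexx _) (ltW f0) (ltW fpi).
have /andP[P0 P2] := J_le (phi p) pi (ltW g0) (ltW gpi) (lexx _).
rewrite cos0 cos_phi // in N2; rewrite cospi cos_phi // opprK in P2.
have bz0 := @band_z0 R M; have bzp := @band_zp R M M0.
(* The scaled area in a polar cap and the indicator of the pole both lie in [[0, 1]], so they differ
   by at most 1. *)
have pole x : 0 <= x -> x <= 2 * pi * (1 / N1) -> 0 <= N1 * x / (4 * pi) <= 1.
  move=> x0 xN; have p4 : 0 < 4 * pi :> R by lra.
  rewrite divr_ge0 ?mulr_ge0 ?pi_ge0 ?(ltW N1_gt0) //=.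
  rewrite ler_pdivrMr // mul1r -ler_pdivlMl // mulrC.
  apply: (le_trans xN); rewrite mul1r ler_pM2r ?invr_gt0 //; lra.
rewrite bz0 opprB addrC subrK in N2.
rewrite bzp bz0 opprB subrK in P2.
have /andP[n1 n2] := pole _ N0 N2; have /andP[p1 p2] := pole _ P0 P2.
rewrite SJ split1.
(* The counting errors sum to [p]; the increments of [V] telescope to at most [2 * pi], whence
   [8 * M]. *)
have bsum : `| \sum_(1 <= j < p.+1) \sum_(1 <= i < (r j).+1)
      (pt j i \in spherical_cap u t)%:R
    - N1 * (\sum_(0 <= j < p) J (phi j) (phi j.+1)) / (4 * pi) |
    <= p%:R + 8 * M%:R.
  rewrite big_add1 /= mulr_sumr mulr_suml -sumrB.
  apply: (le_trans (ler_norm_sum _ _ _)).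
  apply: (@le_trans _ _ (\sum_(0 <= j < p)
     (1 + 4 * M%:R / pi * (V (phi j.+1) - V (phi j))))).
    apply: ler_sum_nat => j /andP[_ jp].
    by rewrite [X in 1 + X]mulrAC; exact: band.
  rewrite big_split /= sumr_const_nat subn0 lerD2l -mulr_sumr telescope_sumr //.
  apply: (@le_trans _ _ (4 * M%:R / pi * (2 * pi))).
    by rewrite ler_wpM2l ?V2 // divr_ge0 ?mulr_ge0 // ltW.
  have p0 : pi != 0 :> R by rewrite gt_eqF.
  by rewrite le_eqVlt; apply/orP; left; apply/eqP; move: (pi : R) p0 => q q0; field.
have pM : p%:R = 2 * M%:R - 1 :> R.
  by rewrite /diamond_p natrB ?natrM // muln_gt0.
move: bsum; rewrite pM.
set S1 := \sum_(_ <= _ < _) _; set S2 := \sum_(_ <= _ < _) _.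
rewrite !ler_norml => /andP[? ?].
have b1 (b : bool) : 0 <= (b%:R : R) <= 1 by case: b; rewrite ?lexx ?ler01.
have /andP[? ?] := b1 (vec3 0 0 1 \in spherical_cap u t).
have /andP[? ?] := b1 (vec3 0 0 (-1) \in spherical_cap u t).
by apply/andP; split; lra.
Qed.

End CapEstimate.

(** * Discrepancy *)

(** The angle is [acos (x / s)], reflected to [2 * pi - acos (x / s)] when [y < 0]. *)
Lemma polar_coordinates (R : realType) (x y : R) :
  exists s be, [/\ 0 <= s, 0 <= be <= 2 * pi, x = s * cos be & y = s * sin be].
Proof.
have ppi := pi_gt0 R; pose s := Num.sqrt (x ^+ 2 + y ^+ 2).
have q0 : 0 <= x ^+ 2 + y ^+ 2 by rewrite addr_ge0 // sqr_ge0.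
have s2 : s ^+ 2 = x ^+ 2 + y ^+ 2 by rewrite sqr_sqrtr.
have [s0|s0] := eqVneq s 0.
  exists 0, 0; rewrite !mul0r lexx mulr_ge0 ?ltW //.
  move: s2; rewrite s0 expr0n /= => /esym/eqP.
  by rewrite paddr_eq0 ?sqr_ge0 // !sqrf_eq0 => /andP[/eqP -> /eqP ->].
have sp : 0 < s by rewrite lt_neqAle eq_sym s0 sqrtr_ge0.
have x1 : -1 <= x / s <= 1.
  rewrite -ler_norml normrM normfV (gtr0_norm sp) ler_pdivrMr // mul1r.
  by rewrite -(gtr0_norm sp) -ler_sqr ?nnegrE // !real_normK ?num_real // s2 lerDl sqr_ge0.
have sn : s * sin (acos (x / s)) = `|y|.
  rewrite sin_acos // -[X in X * _](ger0_norm (ltW sp)) -sqrtr_sqr -sqrtrM ?sqr_ge0 //.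
  have -> : s ^+ 2 * (1 - (x / s) ^+ 2) = s ^+ 2 - x ^+ 2.
    by move: s s0 {s2 sp x1} => a a0; field.
  by rewrite s2 addrC addKr sqrtr_sqr.
have cs : s * cos (acos (x / s)) = x by rewrite acosK ?in_itv // mulrC divfK.
have a0 := acos_ge0 x1; have api := acos_lepi x1.
have [y0|y0] := leP 0 y.
  exists s, (acos (x / s)); split; rewrite ?cs ?sn ?ger0_norm //; first exact: ltW.
  by apply/andP; split; lra.
exists s, (pi *+ 2 - acos (x / s)); split; first exact: ltW.
- by rewrite mulr2n; apply/andP; split; lra.
- by rewrite addrC cosD2pi cosN cs.
- by rewrite addrC sinD2pi sinN mulrN sn ltr0_norm // opprK.
Qed.

Section DiamondDiscrepancy.
Context {R : realType}.
Variables (M : nat) (theta : nat -> R).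
Hypothesis M0 : (0 < M)%N.
Local Notation N := (diamond_N M).
Local Notation p := (diamond_p M).
Local Notation r := (diamond_r M).
Local Notation z := (@diamond_z R M).
Local Notation pt := (diamond_point M theta).

Let NE : N%:R = 4 * M%:R ^+ 2 + 2 :> R.
Proof. by rewrite /diamond_N natrD natrM natrX. Qed.

Let N0 : 0 < N%:R :> R.
Proof. by rewrite NE ltr_wpDl // mulr_ge0 // exprn_ge0. Qed.

Definition cap_deviation (C : set 'rV[R]_3) : R :=
  `| #|` fset_set (diamond M theta `&` C)|%:R / #|` fset_set (diamond M theta)|%:R
     - fine (surface_measure C) / (4 * pi) |.

Lemma cap_deviation_le C : caps C -> cap_deviation C <= (10 * M%:R + 2) / N%:R.
Proof.
move=> [u [t [_ _ ->]]]; rewrite /cap_deviation diamond_card //.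
have [s [be [s0 be0 ux uy]]] := polar_coordinates R (u 0 0) (u 0 1).
have -> : u = vec3 (s * cos be) (s * sin be) (u 0 (@Ordinal 3 2 isT)).
  apply/rowP => -[[|[|[|//]]] i3]; rewrite mxE /= -?ux -?uy; congr (u _ _);
  exact: val_inj.
have [] := diamond_cap_estimate M theta s be (u 0 (@Ordinal 3 2 isT)) t M0 s0 be0.
set S := fine _; set K := (#|` _|)%:R => /andP[S0 S4] h.
have p4 : 0 < 4 * pi :> R by rewrite mulr_gt0 // pi_gt0.
(* Replacing [N - 1] by [N] adds this normalized area to the error, which raises [10 * M + 1] to
   [10 * M + 2]. *)
have w0 : 0 <= S / (4 * pi) <= 1.
  by rewrite divr_ge0 ?(ltW p4) //= ler_pdivrMr // mul1r.
have -> : K / N%:R - S / (4 * pi) = (K - N%:R * (S / (4 * pi))) / N%:R.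
  by rewrite mulrBl [N%:R * _]mulrC mulfK // gt_eqF.
rewrite normrM [X in _ * X]gtr0_norm ?invr_gt0 // ler_pM2r ?invr_gt0 //.
move: h w0; rewrite -!mulrA; move: (S / (4 * pi)) => w.
by rewrite !ler_norml => /andP[? ?] /andP[? ?]; apply/andP; split; lra.
Qed.

Lemma diamond_upper_constant : (10 * M%:R + 2) / N%:R <
  (4 + 2 * Num.sqrt 2) / Num.sqrt N%:R :> R.
Proof.
have q0 : 0 < Num.sqrt N%:R :> R by rewrite sqrtr_gt0.
have qq : Num.sqrt N%:R ^+ 2 = N%:R :> R by rewrite sqr_sqrtr // ltW.
rewrite -{1}qq expr2 invfM mulrA ltr_pM2r ?invr_gt0 // ltr_pdivrMr //.
(* This rational bound suffices: with [2 * M <= sqrt N] the right side is at least [13.6 * M], which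
   exceeds [10 * M + 2] for [M >= 1]. *)
have s2 : 7 / 5 <= Num.sqrt 2 :> R.
  by rewrite -[leLHS]ger0_norm ?divr_ge0 // -sqrtr_sqr ler_sqrt //; lra.
have M1 : 1 <= M%:R :> R by rewrite ler1n.
have qM : 2 * M%:R <= Num.sqrt N%:R :> R.
  rewrite -[leLHS]ger0_norm ?mulr_ge0 // -sqrtr_sqr ler_sqrt ?ltW // NE.
  by rewrite exprMn; lra.
apply: (@lt_le_trans _ _ ((4 + 2 * (7 / 5)) * (2 * M%:R))); first lra.
by apply: ler_pM; lra.
Qed.

Let hemi := spherical_cap (vec3 0 0 1 : 'rV[R]_3) 0.

(** The vertical axis is the degenerate case [s = 0] of the polar form used for general caps. *)
Let hemiE : hemi = spherical_cap (vec3 (0 * cos 0) (0 * sin 0) 1) 0.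
Proof. by rewrite !mul0r. Qed.

Let be0 : 0 <= (0 : R) <= 2 * pi.
Proof. by rewrite lexx mulr_ge0 // pi_ge0. Qed.

Lemma hemisphere_cap : caps hemi.
Proof.
exists (vec3 0 0 1), 0; split=> //; last by apply/andP; split; lra.
by rewrite /sphere2 /= dot_vec3; ring.
Qed.

(** The north pole and the parallels down to the equator give [1 + 2 * M * (M + 1)] points. *)
Lemma hemisphere_card :
  #|` fset_set (diamond M theta `&` hemi)|%:R = N%:R / 2 + 2 * M%:R :> R.
Proof.
rewrite diamond_cap_card //.
have -> : vec3 0 0 1 \in hemi.
  by apply/mem_set; rewrite /hemi /spherical_cap /sphere2 /= !dot_vec3; split; lra.
have -> : (vec3 0 0 (-1) \in hemi) = false.
  apply/negbTE/negP => /set_mem[_]; rewrite dot_vec3; lra.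
rewrite (@big_cat_nat _ _ _ M.+1) //=; last by rewrite /diamond_p; lia.
rewrite [X in _ + (_ + X)]big_nat_cond [X in _ + (_ + X)]big1; last first.
  move=> j; rewrite andbT => /andP[Mj jp]; rewrite big1 // => i _.
  case: j Mj jp => // j Mj jp.
  rewrite hemiE diamond_point_cap //.
  have /andP[z1 z2] := @diamond_z_bound R M M0 j.+1 jp.
  rewrite acosK ?in_itv /= ?(ltW z1) ?(ltW z2) //.
  have zj := @diamond_z_lt R M M0 M j.+1 M0 Mj jp.
  rewrite diamond_z_equator // in zj.
  by rewrite (_ : (_ <= _) = false) //; apply/negbTE; rewrite -ltNge; lra.
have -> : \sum_(1 <= j < M.+1) \sum_(1 <= i < (r j).+1) (pt j i \in hemi)%:R =
    \sum_(1 <= j < M.+1) (r j)%:R :> R.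
  apply: eq_big_nat => -[//|j] /andP[_ jM].
  rewrite (eq_bigr (fun=> 1)) ?sumr_const_nat ?subn1 // => i _.
  have jp : (j < p)%N by rewrite /diamond_p; lia.
  rewrite hemiE diamond_point_cap //.
  have /andP[z1 z2] := @diamond_z_bound R M M0 j.+1 jp.
  rewrite acosK ?in_itv /= ?(ltW z1) ?(ltW z2) //.
  have zj : 0 <= z j.+1.
    move: jM; rewrite ltnS leq_eqVlt => /predU1P[->|jM].
      by rewrite diamond_z_equator.
    have := @diamond_z_lt R M M0 j.+1 M isT jM.
    by rewrite diamond_z_equator // => /(_ _)/ltW -> //; rewrite /diamond_p; lia.
  by rewrite (_ : (_ <= _) = true) //; lra.
rewrite -natr_sum sum_diamond_r_le // !natrM natrD NE.
by field.
Qed.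

(** An upper bound is what a lower bound on the deviation requires: [H <= pi] on the northern half,
    and empty arcs on the southern one. *)
Lemma hemisphere_measure : fine (surface_measure hemi) <= 2 * pi.
Proof.
have ppi := pi_gt0 R.
rewrite hemiE surface_measure_cap //.
have mH := measurable_cap_halfwidth (0 : R) 0 1 0 (lexx _) be0.
have HB x : 0 <= 2 * cap_halfwidth (0 : R) 1 0 x <= 2 * pi.
  by rewrite mulr_ge0 ?halfwidth_ge0 //= ler_pM2l // halfwidth_le_pi.
rewrite -/(sin_integral (fun x => 2 * cap_halfwidth 0 1 0 x) 0 pi).
rewrite (sin_integralD _ (2 * pi) mH HB 0 (pi / 2)) //; [|lra..].
have -> : sin_integral (fun x => 2 * cap_halfwidth (0 : R) 1 0 x) (pi / 2) pi = 0.
  (* The equator is removed first: there the arc is the full circle. *)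
  rewrite /sin_integral -integral_itv_obnd_cbnd.
    rewrite integral0_eq // => x; rewrite /= in_itv /= => /andP[px xpi].
    have cx : cos x < 0.
      by rewrite -(@cos_pihalf R) ltr_cos // in_itv /=; apply/andP; split; lra.
    suff -> : cap_halfwidth 0 1 0 x = 0 by rewrite mulr0 mul0r.
    rewrite /cap_halfwidth /halfwidth (_ : [set _ | _] = set0) ?sup0 //.
    by apply/seteqP; split=> // y /= [_]; lra.
  apply: measurable_funS mH => // x /=; rewrite !in_itv /= => /andP[? ->].
  by rewrite andbT; lra.
rewrite addr0.
apply: (le_trans (sin_integral_le _ (2 * pi) mH HB (2 * pi) 0 (pi / 2) _ _ _ _)).
- by [].
- lra.
- lra.
- by move=> x _; have /andP[] := HB x.
by rewrite cos0 cos_pihalf subr0 mulr1.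
Qed.

Lemma hemisphere_deviation : 2 * M%:R / N%:R <= cap_deviation hemi.
Proof.
rewrite /cap_deviation hemisphere_card diamond_card //.
apply: le_trans (ler_norm _); have ppi := pi_gt0 R.
have : fine (surface_measure hemi) / (4 * pi) <= 1 / 2.
  by rewrite ler_pdivrMr ?mulr_gt0 //; have := hemisphere_measure; lra.
have n0 : N%:R != 0 :> R by rewrite gt_eqF.
have -> : (N%:R / 2 + 2 * M%:R) / N%:R = 1 / 2 + 2 * M%:R / N%:R :> R.
  by move: (N%:R) n0 => n n0; field.
by move=> ?; lra.
Qed.

Lemma cap_discrepancy_le :
  cap_discrepancy (diamond M theta) <= (10 * M%:R + 2) / N%:R.
Proof.
apply: ge_sup; first by exists (cap_deviation hemi), hemi => //; exact: hemisphere_cap.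
by move=> _ [C CC <-]; exact: cap_deviation_le.
Qed.

(** The upper estimate also supplies the boundedness that makes [sup] an actual upper bound. *)
Lemma cap_discrepancy_ge : 2 * M%:R / N%:R <= cap_discrepancy (diamond M theta).
Proof.
apply: (le_trans hemisphere_deviation); apply: ub_le_sup.
  by exists ((10 * M%:R + 2) / N%:R) => _ [C CC <-]; exact: cap_deviation_le.
by exists hemi => //; exact: hemisphere_cap.
Qed.

End DiamondDiscrepancy.

Lemma diamond_error_littleo (R : realType) :
  (fun M => 2 * M%:R / (diamond_N M)%:R - 1 / Num.sqrt (diamond_N M)%:R : R)
  =o_\oo (fun M => 1 / Num.sqrt (diamond_N M)%:R).
Proof.
apply/eqoP => eps eps0; near=> M.
(* This threshold yields [eps * N >= 2], since [N >= M]. *)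
have Meps : 2 / eps <= M%:R by near: M; exact: nbhs_infty_ger.
have NE : (diamond_N M)%:R = 4 * M%:R ^+ 2 + 2 :> R.
  by rewrite /diamond_N natrD natrM natrX.
have N0 : 0 < (diamond_N M)%:R :> R.
  by rewrite NE ltr_wpDl // mulr_ge0 // exprn_ge0.
have epsN : 2 <= eps * (diamond_N M)%:R.
  rewrite -ler_pdivrMl // mulrC; apply: (le_trans Meps).
  by rewrite ler_nat /diamond_N; nia.
have q0 : 0 < Num.sqrt (diamond_N M)%:R :> R by rewrite sqrtr_gt0.
have qq : Num.sqrt (diamond_N M)%:R ^+ 2 = (diamond_N M)%:R :> R.
  by rewrite sqr_sqrtr // ltW.
move: (Num.sqrt _) q0 qq => q q0 qq; rewrite -qq in NE epsN *.
have M0 : 0 <= M%:R :> R by [].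
have qM : 2 * M%:R <= q.
  rewrite -ler_sqr ?nnegrE ?mulr_ge0 ?(ltW q0) // NE exprMn; lra.
have e1 : 2 * M%:R / q ^+ 2 - 1 / q = - ((q - 2 * M%:R) / q ^+ 2).
  by field; rewrite gt_eqF.
have -> : `|1 / q| = 1 / q by rewrite ger0_norm // divr_ge0 // ltW.
rewrite e1 normrN ger0_norm ?divr_ge0 ?subr_ge0 ?exprn_ge0 ?(ltW q0) //.
rewrite ler_pdivrMr ?exprn_gt0 //.
have -> : eps * (1 / q) * q ^+ 2 = eps * q by field; rewrite gt_eqF.
(* [(q - 2 M) (q + 2 M) = 2] *)
rewrite -(ler_pM2r q0); apply: (@le_trans _ _ 2); last by rewrite -mulrA -expr2.
apply: (@le_trans _ _ ((q - 2 * M%:R) * (q + 2 * M%:R))).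
  by rewrite ler_wpM2l ?subr_ge0 // lerDl mulr_ge0.
by rewrite -subr_sqr NE exprMn; lra.
Unshelve. all: by end_near. Qed.

Theorem theorem1p4 (R : realType) :
  exists2 e : nat -> R,
    e =o_\oo (fun M => 1 / Num.sqrt (diamond_N M)%:R) &
    forall (M : nat) (theta : nat -> R),
      (0 < M)%N -> diamond_phases M theta ->
      1 / Num.sqrt (diamond_N M)%:R + e M <= cap_discrepancy (diamond M theta)
      /\ cap_discrepancy (diamond M theta)
           < (4 + 2 * Num.sqrt 2) / Num.sqrt (diamond_N M)%:R.
Proof.
(* The error term is chosen so that the lower bound is exactly the hemisphere bound [2 * M / N]. *)
exists (fun M => 2 * M%:R / (diamond_N M)%:R - 1 / Num.sqrt (diamond_N M)%:R).
  exact: diamond_error_littleo.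
move=> M theta M0 _; split.
  by rewrite addrC subrK; exact: cap_discrepancy_ge.
exact: le_lt_trans (cap_discrepancy_le M theta M0) (diamond_upper_constant M M0).
Qed.
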